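(* Let $\mathcal H^2$ be a two-dimensional complex Hilbert space with orthonormal basis $h_{01},h_{02}$, let $\lambda_0\in\mathbb C$ with $\operatorname{Im}\lambda_0>0$, let $T_d$ be the linear operator in $\mathcal H^2$ with matrix $\begin{pmatrix}\lambda_0&0\\0&-\bar\lambda_0\end{pmatrix}$ in this basis, let $K:\mathbb C^2\to\mathcal H^2$ be given by $K(c_1,c_2)^T=\sqrt{\operatorname{Im}\lambda_0}\,(c_1h_{01}+c_2h_{02})$, and let $$\Theta_d=\begin{pmatrix}T_d&K&I\\ \mathcal H^2&&\mathbb C^2\end{pmatrix}$$ be the canonical L-system with main operator $T_d$, channel operator $K$ and directing operator $I$ (the identity on $\mathbb C^2$). Then the dissipation coefficient $\mathcal D_d$ of $\Theta_d$ is $$\mathcal D_d=\frac{8\operatorname{Im}\lambda_0\,(|\lambda_0|^2+1)}{(|\lambda_0|^2+2\operatorname{Im}\lambda_0+1)^2}.$$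
   Context: $\operatorname{Im}T=\frac1{2i}(T-T^* )$. A canonical L-system is an array $\Theta=\begin{pmatrix}T&K&J\\ \mathcal H&&E\end{pmatrix}$, where $\mathcal H,E$ are Hilbert spaces with $\dim E<\infty$, $T$ is a bounded operator in $\mathcal H$ (main operator), $K:E\to\mathcal H$ is bounded (channel operator), $J$ is a bounded self-adjoint unitary operator in $E$ (directing operator), and $\operatorname{Im}T=KJK^*$. Its transfer function is $W_\Theta(z)=I-2iK^*(T-zI)^{-1}KJ$, $z\in\rho(T)$. The c-Entropy of $\Theta$ is $\mathcal S=-\operatorname{tr}\ln(|W_\Theta(-i)|)$, where $|W|=(W^*W)^{1/2}$, with the convention $\ln 0=-\infty$ (so $\mathcal S=+\infty$ when $W_\Theta(-i)$ is singular). If $\mathcal S\ge 0$, the coefficient of dissipation of $\Theta$ is $\mathcal D=1-e^{-2\mathcal S}$, with $e^{-\infty}=0$. *)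

(* Defs.v *)
From HB Require Import structures.
From mathcomp Require Import all_boot all_order all_algebra.
From mathcomp Require Import all_classical all_reals all_analysis.
From mathcomp Require Import spectral complex.
Set Implicit Arguments.
Unset Strict Implicit.
Unset Printing Implicit Defensive.
Import Order.TTheory GRing.Theory Num.Theory.
Import numFieldNormedType.Exports.
Local Open Scope classical_set_scope.
Local Open Scope ring_scope.
Local Open Scope complex_scope.

(* An inner product on a complex space is a positive definite hermitian form
   of the library: linear in its first argument, conjugate-linear in the
   second one. *)
Notation inner_product U := {dot U for @Num.conj _}.

Section InnerProduct.
Context {R : realType} {U : lmodType R[i]} (ip : inner_product U).

Definition ip_norm (x : U) : R := Num.sqrt (complex.Re (ip x x)).

Definition ip_complete : Prop :=
  forall u : nat -> U,
    (forall e : R, 0 < e -> exists N : nat, forall m n : nat,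
       (N <= m)%N -> (N <= n)%N -> ip_norm (u m - u n) < e) ->
    exists l : U, ip_norm (u n - l) @[n --> \oo] --> (0 : R).

End InnerProduct.

Record hilbertSpace (R : realType) := HilbertSpace {
  hilbert_sort :> lmodType R[i];
  hilbert_ip : inner_product hilbert_sort;
  hilbert_complete : ip_complete hilbert_ip }.

(* Finite-dimensional Hilbert spaces; completeness is automatic. *)
Record finHilbertSpace (R : realType) := FinHilbertSpace {
  finHilbert_sort :> vectType R[i];
  finHilbert_ip : inner_product finHilbert_sort }.

(* C^n with its standard inner product, as row vectors. *)
Definition Cspace (R : realType) (n : nat) : finHilbertSpace R :=
  @FinHilbertSpace R 'rV[R[i]]_n (@dotmx R[i] n).

Section Operators.
Context {R : realType}.

Definition bounded_op (U V : lmodType R[i])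
    (ipU : inner_product U) (ipV : inner_product V) (A : U -> V) : Prop :=
  exists M : R, forall x, ip_norm ipV (A x) <= M * ip_norm ipU x.

(* For A bounded and U complete, Riesz' theorem gives exactly one x' for
   each y. *)
Definition adjoint (U V : lmodType R[i])
    (ipU : inner_product U) (ipV : inner_product V) (A : U -> V) (y : V) : U :=
  xget 0 [set x' | forall x, ipV (A x) y = ipU x x'].

Definition im_op (U : lmodType R[i]) (ip : inner_product U) (T : U -> U)
    (x : U) : U :=
  (2 * 'i)^-1 *: (T x - adjoint ip ip T x).

Definition resolvent_set (U : lmodType R[i]) (ip : inner_product U)
    (T : U -> U) : set R[i] :=
  [set z | exists S : U -> U, [/\ bounded_op ip ip S,
     cancel (fun x => T x - z *: x) S & cancel S (fun x => T x - z *: x)]].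

(* (T - z I)^-1, meaningful for z in the resolvent set. *)
Definition resolvent (U : lmodType R[i]) (T : U -> U) (z : R[i]) (y : U) : U :=
  xget 0 [set x | T x - z *: x = y].

Definition positive_op (U : lmodType R[i]) (ip : inner_product U)
    (P : U -> U) : Prop :=
  forall x, 0 <= ip (P x) x.

(* |A| = (A^* A)^(1/2), the positive square root of A^* A. *)
Definition abs_op (E : vectType R[i]) (ip : inner_product E) (A : E -> E) :
    'End(E) :=
  xget 0 [set P : 'End(E) |
    positive_op ip P /\ forall x, P (P x) = adjoint ip ip A (A x)].

(* Functional calculus for a self-adjoint operator A: phi(A) acts as phi(a)
   on the eigenspace of A for the eigenvalue a. As A is diagonalizable with
   real eigenvalues, this determines phi(A). *)
Definition op_fun (E : vectType R[i]) (phi : R -> R) (A : 'End(E)) : 'End(E) :=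
  xget 0 [set B : 'End(E) |
    forall (a : R) x, A x = a%:C *: x -> B x = (phi a)%:C *: x].

Definition op_trace (E : vectType R[i]) (A : 'End(E)) : R[i] :=
  \tr (passmx.mxof (vbasis {:E}) (vbasis {:E}) A).

End Operators.

Record operator_array (R : realType) (H : hilbertSpace R)
    (E : finHilbertSpace R) := OperatorArray {
  main_op : {linear H -> H};
  channel_op : {linear E -> H};
  directing_op : {linear E -> E} }.

Section LSystem.
Context {R : realType} {H : hilbertSpace R} {E : finHilbertSpace R}.
Variable Theta : operator_array H E.

Let ipH := hilbert_ip H.
Let ipE := finHilbert_ip E.
Let T := main_op Theta.
Let K := channel_op Theta.
Let J := directing_op Theta.

Definition canonical_L_system : Prop :=
  [/\ [/\ bounded_op ipH ipH T, bounded_op ipE ipH K & bounded_op ipE ipE J],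
      forall e, adjoint ipE ipE J e = J e,
      (forall e, adjoint ipE ipE J (J e) = e) /\
        (forall e, J (adjoint ipE ipE J e) = e)
    & forall x, im_op ipH T x = K (J (adjoint ipE ipH K x))].

Definition transfer_function (z : R[i]) (e : E) : E :=
  e - (2 * 'i) *: adjoint ipE ipH K (resolvent T z (K (J e))).

(* The trace is real because ln |W| is self-adjoint; the second branch is
   the convention ln 0 = -oo. *)
Definition c_entropy : \bar R :=
  if `[< bijective (transfer_function (- 'i)) >] then
    (- complex.Re (op_trace
             (op_fun (@ln R) (abs_op ipE (transfer_function (- 'i))))))%:E
  else +oo%E.

(* Only meant for systems with nonnegative c-entropy; expeR -oo = 0. *)
Definition dissipation_coefficient : \bar R :=
  (1 - expeR (- (2%:E * c_entropy)))%E.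

End LSystem.

(* Main.v *)
Require Import Defs.
From mathcomp Require Import all_boot all_order all_algebra.
From mathcomp Require Import all_classical all_reals all_analysis.
From mathcomp Require Import spectral complex ring lra.
Import Order.TTheory GRing.Theory Num.Theory.
Import passmx.
Local Open Scope ring_scope.
Local Open Scope complex_scope.
Set Implicit Arguments.
Unset Strict Implicit.
Unset Printing Implicit Defensive.

(** The system is diagonal: [T] multiplies the orthonormal basis vectors [h j]
    by [t j], and [K] sends the standard basis vector [e j] to [k j *: h j] with
    [|k j|^2 = Im (t j)].  Operators that are diagonal between two orthonormal
    bases are closed under adjoints (the symbol is conjugated), resolvents and
    products, so every object in the definition of an L-system is read off its
    symbol.  The identity [Im T = K K^*] becomes [Im (t j) = |k j|^2], and the
    transfer function at [z] is diagonal with symbol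
      [1 - 2 i |k j|^2 / (t j - z) = (conj (t j) - z) / (t j - z)].

    For the eigenvalues [lambda0] and [- conj lambda0], which are mirror images
    in the imaginary axis, the two values of this symbol at [z = - i] have the
    same modulus [r], where, with [N = |lambda0|^2 + 1] and [b = Im lambda0],
      [r^2 = (N - 2 b) / (N + 2 b) <= 1].
    Hence [W^* W = r^2 I], and the modulus of [W] is the scalar operator [r I]:
    its logarithm and its trace are immediate, the entropy is [- 2 ln r], and
    the dissipation coefficient is
      [1 - r^4 = ((N + 2 b)^2 - (N - 2 b)^2) / (N + 2 b)^2 = 8 b N / (N + 2 b)^2].
    When [lambda0 = i] one has [r = 0]: the transfer function vanishes at [- i],
    the entropy is infinite, and the same formula [1 - r^4] still holds.

    The lemmas that carry this are [diagonal_transfer] (the symbol of the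
    transfer function), [abs_op_scalar] (the modulus) and [dissipation_scalar]
    (the formula [1 - r^(2 dim)], covering both cases). *)

(** * Orthonormal bases *)

Section OrthonormalBasis.
Context {R : realType} {n : nat} {U : lmodType R[i]} (ip : inner_product U).
Variable h : 'I_n -> U.

Definition orthonormal_family : Prop :=
  forall i j, ip (h i) (h j) = (i == j)%:R.

(** Completeness is stated as the Fourier expansion, the form in which it is
    used; [onb_of_span] recovers it from the existence of some expansion. *)
Definition is_onb : Prop :=
  orthonormal_family /\ (forall x, x = \sum_j ip x (h j) *: h j).

Lemma ipC (x y : U) : ip x y = (ip y x)^*%R.
Proof. by rewrite hermC expr0 mul1r. Qed.

Lemma ip_sum_orthonormal (a : 'I_n -> R[i]) k :
  orthonormal_family -> ip (\sum_j a j *: h j) (h k) = a k.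
Proof.
move=> orth; rewrite linear_sumlz (bigD1 k) //= big1 ?addr0.
  by rewrite linearZl_LR /= orth eqxx /= mulr1.
by move=> j jk; rewrite linearZl_LR /= orth (negbTE jk) /= mulr0.
Qed.

Lemma ip_sum_basis (a : 'I_n -> R[i]) k :
  is_onb -> ip (\sum_j a j *: h j) (h k) = a k.
Proof. by case=> orth _; exact: ip_sum_orthonormal. Qed.

Lemma parseval (x y : U) : is_onb ->
  ip x y = \sum_j ip x (h j) * (ip y (h j))^*%R.
Proof.
case=> _ span; rewrite {1}(span x) linear_sumlz.
by apply: eq_bigr => j _; rewrite linearZl_LR /= (ipC (h j) y).
Qed.

Lemma onb_ext (x y : U) : is_onb ->
  (forall j, ip x (h j) = ip y (h j)) -> x = y.
Proof.
case=> _ span xy; rewrite (span x) (span y).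
by apply: eq_bigr => j _; rewrite xy.
Qed.

Lemma onb_of_span : orthonormal_family ->
  (forall x, exists a : 'I_n -> R[i], x = \sum_j a j *: h j) -> is_onb.
Proof.
move=> orth span; split=> // x; have [a ->] := span x.
by apply: eq_bigr => k _; rewrite ip_sum_orthonormal.
Qed.

End OrthonormalBasis.

Lemma dotmx_delta (R : realType) n (x : 'rV[R[i]]_n) j :
  dotmx x (delta_mx 0 j) = x 0 j.
Proof. by rewrite dotmxE trmx_delta map_delta_mx -colE mxE. Qed.

Lemma Cspace_onb (R : realType) n :
  is_onb (finHilbert_ip (Cspace R n)) (fun j : 'I_n => delta_mx 0 j).
Proof.
split=> [i j|x] /=; first by rewrite dotmx_delta mxE eqxx eq_sym.
by rewrite {1}[x]row_sum_delta; apply: eq_bigr => j _; rewrite dotmx_delta.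
Qed.

(** * Adjoints and resolvents from a characterisation *)

(** The adjoint is a choice among the solutions of an equation, so an explicit
    solution identifies it once solutions are unique.  Uniqueness holds because
    the form is positive definite: two candidates have the same inner product
    with their difference. *)
Lemma adjoint_eq (R : realType) (U V : lmodType R[i]) (ipU : inner_product U)
    (ipV : inner_product V) (A : U -> V) (y : V) (x' : U) :
  (forall x, ipV (A x) y = ipU x x') -> adjoint ipU ipV A y = x'.
Proof.
move=> Hx'; rewrite /adjoint.
set P := (X in xget _ X).
have /xgetPex : exists x, P x by exists x'.
move=> /(_ 0); rewrite /P /=; set z := xget _ _ => Hz.
apply/eqP; rewrite -subr_eq0 -(dnorm_eq0 ipU).
by rewrite linearBr /= -Hx' -Hz subrr.
Qed.

Lemma resolvent_eq (R : realType) (U : lmodType R[i]) (T S : U -> U) (z : R[i]) :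
  cancel (fun x => T x - z *: x) S -> cancel S (fun x => T x - z *: x) ->
  resolvent T z =1 S.
Proof.
move=> TS ST y; rewrite /Defs.resolvent.
set P := (X in xget _ X).
have /xgetPex : exists x, P x by exists (S y); exact: ST.
by move=> /(_ 0) <-; rewrite TS.
Qed.

(** * Operators that are diagonal between orthonormal bases *)

Section Diagonal.
Context {R : realType} {n : nat}.

(** For orthonormal bases this says that [A] maps [h j] to [d j *: g j] and is
    linear.  The version on coordinates makes sense for a bare function, so that
    it applies to the adjoint and the resolvent, which are not given as linear
    maps. *)
Definition diagonal {U V : lmodType R[i]} (ipU : inner_product U)
    (ipV : inner_product V) (h : 'I_n -> U) (g : 'I_n -> V)
    (d : 'I_n -> R[i]) (A : U -> V) : Prop :=
  forall x j, ipV (A x) (g j) = d j * ipU x (h j).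

Lemma diagonal_linear (U V : lmodType R[i]) (ipU : inner_product U)
    (ipV : inner_product V) (h : 'I_n -> U) (g : 'I_n -> V)
    (d : 'I_n -> R[i]) (A : {linear U -> V}) :
  is_onb ipU h -> is_onb ipV g -> (forall j, A (h j) = d j *: g j) ->
  diagonal ipU ipV h g d A.
Proof.
move=> oh og Ah x j; rewrite {1}(oh.2 x) linear_sum.
under eq_bigr => k _ do rewrite linearZ /= Ah scalerA.
by rewrite ip_sum_basis // mulrC.
Qed.

Context {U V : lmodType R[i]} {ipU : inner_product U} {ipV : inner_product V}.
Context {h : 'I_n -> U} {g : 'I_n -> V} (oh : is_onb ipU h) (og : is_onb ipV g).

Lemma diagonal_adjoint d (A : U -> V) : diagonal ipU ipV h g d A ->
  diagonal ipV ipU g h (fun j => (d j)^*%R) (adjoint ipU ipV A).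
Proof.
move=> dA y j.
rewrite (@adjoint_eq _ _ _ ipU ipV A y
           (\sum_j ((d j)^*%R * ipV y (g j)) *: h j)).
  by rewrite ip_sum_basis.
move=> x; rewrite (parseval _ _ og) (parseval _ _ oh).
apply: eq_bigr => k _; rewrite ip_sum_basis // dA rmorphM /= conjCK.
by rewrite [RHS]mulrCA mulrA.
Qed.

(** By Parseval the sum of the moduli of the symbol is an operator bound. *)
Lemma diagonal_bounded d (A : U -> V) : diagonal ipU ipV h g d A ->
  bounded_op ipU ipV A.
Proof.
move=> dA; pose m : R[i] := \sum_j `|d j|.
have m0 : 0 <= m by apply: sumr_ge0.
exists (complex.Re m) => x.
have rm : m = (complex.Re m)%:C by rewrite RRe_real // ger0_real.
have m0' : 0 <= complex.Re m by move: m0; rewrite rm ler0c.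
rewrite /ip_norm -{1}(ger0_norm m0') -sqrtr_sqr -sqrtrM ?sqr_ge0 //.
apply: ler_wsqrtr.
suff : ipV (A x) (A x) <= (complex.Re m ^+ 2)%:C * ipU x x.
  (* Comparing complex numbers compares their real parts. *)
  by rewrite lecE; case: (ipU x x) => a b /= => /andP[_]; rewrite mul0r subr0.
rewrite rmorphXn /= -rm (parseval _ _ og) (parseval _ _ oh) mulr_sumr.
apply: ler_sum => j _; rewrite -!normCK dA normrM exprMn.
apply: ler_wpM2r; first exact: exprn_ge0.
rewrite ler_sqr ?nnegrE // /m (bigD1 j) //= lerDl; exact: sumr_ge0.
Qed.

End Diagonal.

Section DiagonalResolvent.
Context {R : realType} {n : nat} {U : lmodType R[i]} {ip : inner_product U}.
Context {h : 'I_n -> U} (oh : is_onb ip h) {t : 'I_n -> R[i]}.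
Context {T : U -> U} (dT : diagonal ip ip h h t T).
Context {z : R[i]} (tz : forall j, t j != z).

Let S (y : U) : U := \sum_j ((t j - z)^-1 * ip y (h j)) *: h j.

Let dS : diagonal ip ip h h (fun j => (t j - z)^-1) S.
Proof. by move=> y j; rewrite ip_sum_basis. Qed.

Let dTz : diagonal ip ip h h (fun j => t j - z) (fun x => T x - z *: x).
Proof. by move=> x j; rewrite linearBl linearZl_LR /= dT mulrBl. Qed.

Let TS : cancel (fun x => T x - z *: x) S.
Proof.
by move=> x; apply: (onb_ext oh) => j; rewrite dS dTz mulKf // subr_eq0.
Qed.

Let ST : cancel S (fun x => T x - z *: x).
Proof.
by move=> x; apply: (onb_ext oh) => j; rewrite dTz dS mulVKf // subr_eq0.
Qed.

Lemma diagonal_resolvent_set : resolvent_set ip T z.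
Proof. by exists S; split=> //; apply: (diagonal_bounded oh oh dS). Qed.

Lemma diagonal_resolvent :
  diagonal ip ip h h (fun j => (t j - z)^-1) (resolvent T z).
Proof. by move=> y j; rewrite (resolvent_eq TS ST) dS. Qed.

End DiagonalResolvent.

(** * Operators whose modulus is a scalar *)

Section ScalarModulus.
Context {R : realType} {E : vectType R[i]} (ip : inner_product E).

(** A positive square root [P] of [r^2] satisfies [(P + r) (P - r) = 0], so
    [y = P x - r x] is a solution of [P y = - r y]; positivity of [P] forces
    [y = 0].  Uniqueness of the square root is thus obtained without any
    spectral theory. *)
Lemma abs_op_scalar (A : E -> E) (r : R) : 0 < r ->
  (forall x, adjoint ip ip A (A x) = (r ^+ 2)%:C *: x) ->
  abs_op ip A = r%:C *: \1%VF.
Proof.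
move=> r0 AA; rewrite /abs_op.
set S := (X in xget _ X).
have /xgetPex : exists P, S P.
  exists (r%:C *: \1%VF); split=> x.
    rewrite scale_lfunE id_lfunE linearZl_LR /=.
    by rewrite mulr_ge0 ?dnorm_ge0 // ler0c ltW.
  by rewrite !scale_lfunE !id_lfunE AA scalerA -rmorphM.
move=> /(_ 0); set P := xget _ _ => -[Ppos PP].
apply/lfunP => x; rewrite scale_lfunE id_lfunE.
pose y := P x - r%:C *: x.
have Py : P y = - r%:C *: y.
  by rewrite /y linearB linearZ /= PP AA scalerBr scalerA rmorphXn expr2
    mulNr !scaleNr opprK addrC.
apply/eqP; rewrite -subr_eq0 -/y -(dnorm_eq0 ip) eq_le dnorm_ge0 andbT.
have := Ppos y; rewrite Py linearZl_LR /= mulNr oppr_ge0.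
by rewrite pmulr_rle0 // ltcR.
Qed.

Lemma op_fun_scalar (phi : R -> R) (a : R) :
  op_fun phi (a%:C *: \1%VF : 'End(E)) = (phi a)%:C *: \1%VF.
Proof.
rewrite /op_fun.
set S := (X in xget _ X).
have /xgetPex : exists P, S P.
  exists ((phi a)%:C *: \1%VF) => b x.
  rewrite !scale_lfunE !id_lfunE => /eqP.
  rewrite -subr_eq0 -scalerBl scaler_eq0 subr_eq0 => /orP[/eqP[->] //|/eqP->].
  by rewrite !scaler0.
move=> /(_ 0); set P := xget _ _ => HP.
by apply/lfunP => x; rewrite (HP a) !scale_lfunE !id_lfunE.
Qed.

Lemma op_trace_scalar (c : R[i]) :
  op_trace (c *: \1%VF : 'End(E)) = c * (\dim {:E})%:R.
Proof.
rewrite /op_trace (linearZ_LR (mxof _ _)) /= mxof1 ?(basis_free (vbasisP _)) //.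
by rewrite linearZ /= mxtrace1.
Qed.

End ScalarModulus.

(** * Entropy and dissipation when the transfer function has scalar modulus *)

(** If the symbol [w] of the transfer function at [- i] has constant modulus
    [r], then the transfer function is [r] times a unitary operator. *)
Section DiagonalTransfer.
Context {R : realType} {H : hilbertSpace R} {E : finHilbertSpace R}.
Context {Theta : operator_array H E} {n : nat} {g : 'I_n -> E}.
Let ipE := finHilbert_ip E.
Context (og : is_onb ipE g) {w : 'I_n -> R[i]}.
Context (dW : diagonal ipE ipE g g w (transfer_function Theta (- 'i))).
Context {r : R} (wr : forall j, `|w j| = r%:C).

Lemma c_entropy_scalar : 0 < r ->
  c_entropy Theta = (- ((\dim {:E})%:R * ln r))%:E.
Proof.
move=> r0; have w0 j : w j != 0.
  by rewrite -normr_eq0 wr; apply/eqP => -[] /eqP; rewrite gt_eqF.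
have bW : bijective (transfer_function Theta (- 'i)).
  exists (fun y => \sum_j ((w j)^-1 * ipE y (g j)) *: g j) => x;
    apply: (onb_ext og) => j.
    by rewrite ip_sum_basis // dW mulKf.
  by rewrite dW ip_sum_basis // mulVKf.
rewrite /c_entropy asboolT // (abs_op_scalar r0); last first.
  move=> x; apply: (onb_ext og) => j.
  rewrite (diagonal_adjoint og og dW) dW linearZl_LR /= mulrA; congr (_ * _).
  by rewrite mulrC -normCK wr rmorphXn.
rewrite op_fun_scalar op_trace_scalar -(rmorph_nat (real_complex R)).
by rewrite -rmorphM /= mulrC.
Qed.

(** Here the transfer function is zero, and it is not injective because [E]
    contains a unit vector. *)
Lemma c_entropy_singular : (0 < n)%N -> r = 0 -> c_entropy Theta = +oo%E.
Proof.
move=> n0 r0; rewrite /c_entropy asboolF // => /bij_inj inj.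
pose j := Ordinal n0.
have W0 x : transfer_function Theta (- 'i) x = 0.
  apply: (onb_ext og) => k; rewrite dW linear0l.
  by have /eqP := wr k; rewrite r0 normr_eq0 => /eqP ->; rewrite mul0r.
have := og.1 j j; rewrite (inj (g j) 0) ?W0 // linear0l eqxx => /esym/eqP.
by rewrite oner_eq0.
Qed.

Hypothesis n_gt0 : (0 < n)%N.

Let r_ge0 : 0 <= r.
Proof. by rewrite -ler0c -(wr (Ordinal n_gt0)). Qed.

Lemma c_entropy_scalar_ge0 : r <= 1 -> (0 <= c_entropy Theta)%E.
Proof.
move=> r1; have [r0|rn0] := eqVneq r 0.
  by rewrite c_entropy_singular.
rewrite c_entropy_scalar ?lt_def ?rn0 // lee_fin oppr_ge0.
by rewrite mulr_ge0_le0 // ln_le0.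
Qed.

(** For [r > 0] this is [1 - exp (2 dim ln r)].  For [r = 0] the entropy is
    infinite and the coefficient is [1]; the power [0 ^ (2 dim)] agrees with
    this as [dim > 0]. *)
Lemma dissipation_scalar :
  dissipation_coefficient Theta = (1 - r ^+ (2 * \dim {:E}))%:E.
Proof.
rewrite /dissipation_coefficient; have [r0|rn0] := eqVneq r 0.
  rewrite c_entropy_singular // mulry gtr0_sg // mul1e /= r0 expr0n.
  have [|_] := eqVneq (2 * \dim {:E})%N 0%N; last by rewrite subr0 sube0.
  (* A space of dimension 0 has no unit vector. *)
  move=> /eqP; rewrite muln_eq0 /= dimv_eq0 => /eqP E0.
  have := og.1 (Ordinal n_gt0) (Ordinal n_gt0).
  have : g (Ordinal n_gt0) \in fullv by exact: memvf.
  rewrite E0 memv0 => /eqP ->; rewrite linear0l eqxx => /esym/eqP.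
  by rewrite oner_eq0.
have rp : 0 < r by rewrite lt_def rn0.
rewrite c_entropy_scalar // -EFinM -EFinN /= -EFinB; congr (1 - _)%:E.
by rewrite mulrN opprK mulrA -natrM expRM_natl lnK.
Qed.

End DiagonalTransfer.

(** * Diagonal L-systems *)

Section DiagonalSystem.
Context {R : realType} {H : hilbertSpace R} {E : finHilbertSpace R}.
Let ipH := hilbert_ip H.
Let ipE := finHilbert_ip E.
Context {n : nat} {h : 'I_n -> H} {g : 'I_n -> E}.
Context (oh : is_onb ipH h) (og : is_onb ipE g).
Context {t k : 'I_n -> R[i]} {T : {linear H -> H}} {K : {linear E -> H}}.
Context (Th : forall j, T (h j) = t j *: h j).
Context (Kg : forall j, K (g j) = k j *: h j).
Context (tk : forall j, k j * (k j)^*%R = (complex.Im (t j))%:C).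

Let Theta := OperatorArray T K (idfun : {linear E -> E}).
Let dT := diagonal_linear oh oh Th.
Let dK := diagonal_linear og oh Kg.

Lemma diagonal_system_canonical : canonical_L_system Theta.
Proof.
have Jadj e : adjoint ipE ipE idfun e = e by exact: adjoint_eq.
split=> //=.
- split; [exact: diagonal_bounded dT|exact: diagonal_bounded dK|].
  by exists 1 => x; rewrite mul1r.
- move=> x; apply: (onb_ext oh) => j.
  rewrite dK (diagonal_adjoint og oh dK) mulrA tk /im_op.
  rewrite linearZl_LR linearBl /= dT (diagonal_adjoint oh oh dT) -mulrBl mulrA.
  congr (_ * _); rewrite [t j - _]subcJ -[2 * _ * _]mulrAC mulKf //.
  by rewrite mulf_neq0 ?pnatr_eq0 // neq0Ci.
Qed.

(** The symbol is [1 - 2 i |k j|^2 / (t j - z)], and the numerator simplifies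
    since [2 i |k j|^2 = 2 i Im (t j) = t j - conj (t j)]. *)
Lemma diagonal_transfer (z : R[i]) : (forall j, t j != z) ->
  diagonal ipE ipE g g (fun j => ((t j)^*%R - z) / (t j - z))
    (transfer_function Theta z).
Proof.
move=> tz x j; rewrite /transfer_function linearBl linearZl_LR /=.
rewrite (diagonal_adjoint og oh dK) (diagonal_resolvent oh dT tz) dK.
have tz0 : t j - z != 0 by rewrite subr_eq0.
rewrite /=; have -> : (t j)^*%R = t j - 2 * 'i * (k j * (k j)^*%R).
  have := subcJ (t j); rewrite mulrAC -tk => <-.
  by rewrite opprB addrCA subrr addr0.
by field.
Qed.

End DiagonalSystem.

(** * Two eigenvalues symmetric in the imaginary axis *)

Lemma sqnorm_conjD (R : realType) (l : R[i]) : `|l^*%R + 'i%R| ^+ 2 =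
  (complex.Re l ^+ 2 + complex.Im l ^+ 2 + 1 - 2 * complex.Im l)%:C.
Proof. by rewrite -add_Re2_Im2; case: l => a b /=; congr (_%:C); ring. Qed.

Lemma sqnormD (R : realType) (l : R[i]) : `|l + 'i%R| ^+ 2 =
  (complex.Re l ^+ 2 + complex.Im l ^+ 2 + 1 + 2 * complex.Im l)%:C.
Proof. by rewrite -add_Re2_Im2; case: l => a b /=; congr (_%:C); ring. Qed.

Lemma Re_norm_sqr (R : realType) (l : R[i]) :
  complex.Re `|l| ^+ 2 = complex.Re l ^+ 2 + complex.Im l ^+ 2.
Proof. by rewrite normc_def /= sqr_sqrtr // addr_ge0 ?sqr_ge0. Qed.

Lemma ord2_case (P : 'I_2 -> Prop) : P ord0 -> P ord_max -> forall j, P j.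
Proof.
move=> P0 P1 j; case: (unliftP ord_max j) => [j' ->|-> //].
by rewrite (_ : lift _ _ = ord0) //; apply/val_inj; case: j' => -[].
Qed.

Theorem theorem8 (R : realType) (H2 : hilbertSpace R) (h01 h02 : H2)
    (h01_unit : hilbert_ip H2 h01 h01 = 1)
    (h02_unit : hilbert_ip H2 h02 h02 = 1)
    (h01_h02_orth : hilbert_ip H2 h01 h02 = 0)
    (h_span : forall x : H2, exists a b : R[i], x = a *: h01 + b *: h02)
    (lambda0 : R[i]) (lambda0_im : 0 < complex.Im lambda0)
    (Td : {linear H2 -> H2})
    (Td_h01 : Td h01 = lambda0 *: h01)
    (Td_h02 : Td h02 = - lambda0^* *: h02)
    (K : {linear Cspace R 2 -> H2})
    (K_def : forall c : 'rV[R[i]]_2,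
       K c = (Num.sqrt (complex.Im lambda0))%:C
               *: (c ord0 ord0 *: h01 + c ord0 ord_max *: h02)) :
  let Theta_d := OperatorArray Td K (idfun : {linear Cspace R 2 -> Cspace R 2}) in
  let abs_lambda0 : R := complex.Re `|lambda0| in
  [/\ canonical_L_system Theta_d,
      resolvent_set (hilbert_ip H2) Td (- 'i),
      (0 <= c_entropy Theta_d)%E
    & dissipation_coefficient Theta_d =
      (8 * complex.Im lambda0 * (abs_lambda0 ^+ 2 + 1)
        / (abs_lambda0 ^+ 2 + 2 * complex.Im lambda0 + 1) ^+ 2)%:E].
Proof.
move=> Theta abs_lambda0.
pose h (j : 'I_2) := if j == ord0 then h01 else h02.
pose t (j : 'I_2) : R[i] := if j == ord0 then lambda0 else - lambda0^*%R.
pose b := complex.Im lambda0; pose k (_ : 'I_2) := (Num.sqrt b)%:C.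
have oh : is_onb (hilbert_ip H2) h.
  apply: onb_of_span; last first.
    move=> x; have [a1 [a2 ->]] := h_span x.
    exists (fun j => if j == ord0 then a1 else a2).
    by rewrite big_ord_recl big_ord1.
  by apply: ord2_case; apply: ord2_case; rewrite /h //= ipC h01_h02_orth rmorph0.
have Th : forall j, Td (h j) = t j *: h j by apply: ord2_case.
have Kg : forall j, K (delta_mx 0 j) = k j *: h j.
  by apply: ord2_case; rewrite K_def !mxE /h /= scale1r scale0r ?addr0 ?add0r.
have Imt : forall j, complex.Im (t j) = b.
  by apply: ord2_case; rewrite /t /b //=; case: (lambda0) => x y /=; rewrite opprK.
have tk : forall j, k j * (k j)^*%R = (complex.Im (t j))%:C.
  by move=> j; rewrite Imt -normCK -add_Re2_Im2 /= expr0n addr0 sqr_sqrtr ?ltW.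
have tz : forall j, t j != - 'i%R.
  move=> j; apply/eqP => tj; have := Imt j; rewrite tj /= => bN.
  by move: lambda0_im; rewrite -/b -bN oppr_gt0 ltr10.
pose N := abs_lambda0 ^+ 2 + 1.
have NE : N = complex.Re lambda0 ^+ 2 + b ^+ 2 + 1.
  by rewrite /N Re_norm_sqr.
(* The difference is (Re lambda0)^2 + (b - 1)^2. *)
have Nb : 0 <= N - 2 * b.
  by rewrite NE; have := sqr_ge0 (complex.Re lambda0); have := sqr_ge0 (b - 1); nra.
have b0 : 0 < b by [].
have Nb' : 0 < N + 2 * b by lra.
pose q := (N - 2 * b) / (N + 2 * b).
have q0 : 0 <= q by rewrite divr_ge0 // ltW.
have q1 : q <= 1 by rewrite ler_pdivrMr // mul1r; lra.
have Ret : forall j, complex.Re (t j) ^+ 2 = complex.Re lambda0 ^+ 2.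
  by apply: ord2_case; rewrite /t //=; case: (lambda0) => x y /=; rewrite sqrrN.
(* The modulus of the symbol depends on t j through (Re (t j))^2 and Im (t j)
   only, which both eigenvalues share. *)
have num j : `|(t j)^*%R + 'i%R| ^+ 2 = (N - 2 * b)%:C.
  by rewrite sqnorm_conjD Imt Ret NE.
have den j : `|t j + 'i%R| ^+ 2 = (N + 2 * b)%:C.
  by rewrite sqnormD Imt Ret NE.
have wr j : `|((t j)^*%R - - 'i%R) / (t j - - 'i%R)| = (Num.sqrt q)%:C.
  apply/eqP; rewrite -(@eqrXn2 _ 2) ?normr_ge0 ?ler0c ?sqrtr_ge0 //.
  rewrite opprK normf_div expr_div_n num den -rmorphXn sqr_sqrtr //.
  by rewrite -fmorph_div.
have dW := diagonal_transfer oh (Cspace_onb R 2) Th Kg tk tz.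
have og := Cspace_onb R 2.
split.
- exact: (diagonal_system_canonical oh og Th Kg tk).
- exact: (diagonal_resolvent_set oh (diagonal_linear oh oh Th) tz).
- apply: (c_entropy_scalar_ge0 og dW wr) => //.
  by rewrite -sqrtr1 ler_sqrt.
- rewrite (dissipation_scalar og dW wr) //; congr (_%:E).
  rewrite dimvf dim_matrix exprM sqr_sqrtr //= /q.
  rewrite (_ : abs_lambda0 ^+ 2 + 2 * complex.Im lambda0 + 1 = N + 2 * b); last first.
    by rewrite /N -/b addrAC.
  rewrite -/N -/b; field.
  by rewrite gt_eqF.
Qed.
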